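(* Let $(R,\mathfrak m)$ be a finite commutative local ring with identity $1\neq0$, $r=|R|$ and $m=|\mathfrak m|$. Then $\{G_R,G_R^+,\bar G_R\}$ are equienergetic non-isospectral Ramanujan graphs if and only if $r=m^2$ is odd.
   Context: $G_R$ is the graph with vertex set $R$ in which $v,w$ are adjacent iff $w-v\in R^*$ (the group of units of $R$); $G_R^+$ is the graph with vertex set $R$ in which $v,w$ are adjacent iff $v+w\in R^*$ (with a loop at $x$ when $x+x\in R^*$); $\bar G_R$ is the (loopless) complement of $G_R$. All are regular (a loop contributes $1$ to the degree). Eigenvalues are those of the adjacency matrix (a loop gives a diagonal entry $1$). The energy is the sum of the absolute values of the eigenvalues with multiplicity. A set of graphs with the same number of vertices is equienergetic if all have the same energy, and non-isospectral if they have pairwise different spectra (eigenvalues with multiplicities). A $k$-regular graph is Ramanujan if every eigenvalue $\lambda$ with $|\lambda|\neq k$ satisfies $|\lambda|\le 2\sqrt{k-1}$ (connectedness is not required). *)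

(* Defs.v *)
From HB Require Import structures.
From mathcomp Require Import all_boot all_order all_fingroup all_algebra all_field.

Set Implicit Arguments.
Unset Strict Implicit.
Unset Printing Implicit Defensive.

Import Order.TTheory GRing.Theory Num.Theory.
Local Open Scope ring_scope.

Section LocalRing.
Variable R : finComUnitRingType.

(* [idealr_closed J] already entails 1 \notin J, i.e. that J is proper. *)
Definition maximal_ideal (I : {set R}) : Prop :=
  idealr_closed I /\
  forall J : {set R}, idealr_closed J -> I \subset J -> J = I.

Definition local_ring (m : {set R}) : Prop :=
  maximal_ideal m /\ forall I : {set R}, maximal_ideal I -> I = m.

End LocalRing.

(* Undirected graphs in which loops are allowed. *)
Record graph (T : finType) := Graph {
  edge :> rel T;
  edge_sym : symmetric edge
}.

Section GraphSpectra.
Variable T : finType.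
Implicit Types (G H : graph T) (Gs : seq (graph T)).

Definition adjacency G : 'M[algC]_#|T| :=
  \matrix_(i, j) (G (enum_val i) (enum_val j))%:R.

(* The eigenvalues with algebraic multiplicity, in an unspecified order; see
   [char_poly_adjacency]. *)
Definition spectrum G : seq algC :=
  sval (closed_field_poly_normal (char_poly (adjacency G))).

Lemma char_poly_adjacency G :
  char_poly (adjacency G) = \prod_(z <- spectrum G) ('X - z%:P).
Proof.
rewrite /spectrum; case: closed_field_poly_normal => s /= {1}->.
by rewrite (monicP (char_poly_monic _)) scale1r.
Qed.

Definition energy G : algC := \sum_(z <- spectrum G) `|z|.

(* A loop at x contributes 1 to the degree of x. *)
Definition regular (k : nat) G : Prop := forall x, #|[set y | G x y]| = k.

(* For k = 0 the bound is vacuous: the only eigenvalue is 0. *)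
Definition ramanujan G : Prop :=
  exists2 k : nat, regular k G &
    forall a : algC, eigenvalue (adjacency G) a ->
      `|a| != k%:R -> `|a| <= 2 * sqrtC (k%:R - 1).

(* A "set of graphs" is a list: the conditions below apply to any two entries
   at different positions, even if these entries are the same graph. *)
Definition equienergetic Gs : Prop :=
  pairwise (fun G H => energy G == energy H) Gs.

Definition non_isospectral Gs : Prop :=
  pairwise (fun G H => ~~ perm_eq (spectrum G) (spectrum H)) Gs.

Definition all_ramanujan Gs : Prop :=
  foldr (fun G P => ramanujan G /\ P) True Gs.

Definition compl_rel G : rel T := fun x y => (x != y) && ~~ G x y.

Lemma compl_rel_sym G : symmetric (compl_rel G).
Proof. by move=> x y; rewrite /compl_rel eq_sym edge_sym. Qed.

Definition compl_graph G : graph T := Graph (compl_rel_sym G).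

End GraphSpectra.

Section UnitaryCayley.
Variable R : finComUnitRingType.

Definition cayley_rel : rel R := fun v w => w - v \is a GRing.unit.

Lemma cayley_rel_sym : symmetric cayley_rel.
Proof. by move=> v w; rewrite /cayley_rel -opprB unitrN. Qed.

Definition unitary_cayley : graph R := Graph cayley_rel_sym.

Definition cayley_sum_rel : rel R := fun v w => v + w \is a GRing.unit.

Lemma cayley_sum_rel_sym : symmetric cayley_sum_rel.
Proof. by move=> v w; rewrite /cayley_sum_rel addrC. Qed.

Definition unitary_cayley_sum : graph R := Graph cayley_sum_rel_sym.

End UnitaryCayley.

(* Main.v *)
Require Import Defs.
From HB Require Import structures.
From mathcomp Require Import all_boot all_order all_fingroup all_algebra all_field.
From mathcomp Require Import cyclic pgroup.
From mathcomp Require Import zify ring.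

Set Implicit Arguments.
Unset Strict Implicit.
Unset Printing Implicit Defensive.

Import Order.TTheory GRing.Theory Num.Theory.
Local Open Scope ring_scope.

(** A finite local ring splits into its maximal ideal m, the set of nonunits,
    and the units.  Hence v and w are adjacent in G_R iff they lie in different
    cosets of m: G_R is a complete multipartite graph with parts of size #|m|,
    and is regular of degree k = #|R| - #|m|.  Counting common neighbours, its
    adjacency matrix satisfies A ^ 2 + m A = k J, with m standing for #|m| and J
    for the all-ones matrix, so that its eigenvalues are among 0, - m and k
    ([multipartite_eigenvalue]); those of the complement, a disjoint union of
    complete graphs on m vertices, are among - 1 and m - 1
    ([compl_multipartite_eigenvalue]).

    These finite sets of values determine the energies without a computation of
    multiplicities: the absolute value agrees on them with a quadratic
    polynomial, while the power sums of the spectrum are traces, the eigenvalues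
    adding up to the number of loops, and their squares to the number of
    vertices times the degree ([energy_quadratic]).  The energies of G_R and of
    its complement are thus 2 k and 2 #|R| (m - 1) / m, and these agree exactly
    when #|R| = m ^ 2.

    The involution z -> - z turns the common neighbours in G_R into the common
    neighbours in G_R^+, so that the two adjacency matrices have the same square
    and the eigenvalues of the two graphs have the same absolute values
    ([common_neighbors_norm_spectrum]).  Therefore the two graphs always have the
    same energy, and one is Ramanujan when the other is.  If #|R| is even, then
    2 is not a unit, x + y and y - x differ by an element of the maximal ideal,
    and G_R^+ is equal to G_R; so #|R| must be odd for the spectra to differ.

    Conversely, let #|R| = m ^ 2 be odd.  Power sums tell the three graphs
    apart: 2 is a unit, so that G_R^+ has k > 0 loops whereas the other two
    graphs have none, and G_R and its complement have different degrees.  Since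
    m >= 3, the Ramanujan bounds m ^ 2 <= 4 (m ^ 2 - m - 1) and 1 <= 4 (m - 2)
    hold. *)

(** * Matrices conjugate to a diagonal matrix *)

Lemma char_poly_conj_diag (R : comUnitRingType) n (P : 'M[R]_n) (d : 'rV_n) :
  P \in unitmx ->
  char_poly (invmx P *m diag_mx d *m P)
    = \prod_(z <- [seq d 0 i | i : 'I_n]) ('X - z%:P).
Proof.
move=> Pu.
have dE : char_poly (diag_mx d) = \prod_(z <- [seq d 0 i | i : 'I_n]) ('X - z%:P).
  rewrite big_map big_enum char_poly_trig ?diag_mx_is_trig //=.
  by apply: eq_bigr => i _; rewrite !mxE eqxx mulr1n.
rewrite -dE /char_poly.
have -> : char_poly_mx (invmx P *m diag_mx d *m P) =
    map_mx polyC (invmx P) *m char_poly_mx (diag_mx d) *m map_mx polyC P.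
  rewrite /char_poly_mx mulmxBr mulmxBl -!map_mxM; congr (_ - _).
  by rewrite mul_mx_scalar -scalemxAl -map_mxM mulVmx // map_mx1 scalemx1.
rewrite !det_mulmx mulrC mulrA -det_mulmx -map_mxM mulmxV //.
by rewrite map_mx1 det1 mul1r.
Qed.

Lemma conj_sqr (R : comUnitRingType) n (P D : 'M[R]_n) : P \in unitmx ->
  (invmx P *m D *m P) *m (invmx P *m D *m P) = invmx P *m (D *m D) *m P.
Proof. by move=> Pu; rewrite !mulmxA mulmxK. Qed.

Lemma mxtrace_conj (R : comUnitRingType) n (P D : 'M[R]_n) : P \in unitmx ->
  \tr (invmx P *m D *m P) = \tr D.
Proof. by move=> Pu; rewrite mxtrace_mulC mulKVmx. Qed.

Lemma diag_sqr (R : comUnitRingType) n (d : 'rV[R]_n) :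
  diag_mx d *m diag_mx d = diag_mx (\row_i d 0 i ^+ 2).
Proof.
by rewrite mulmx_diag; congr diag_mx; apply/rowP=> i; rewrite !mxE.
Qed.

(** * Spectra of graphs and power sums *)

Section Spectra.
Variable T : finType.
Implicit Types G H : graph T.

Lemma adjacency_tr G : (adjacency G)^T = adjacency G.
Proof. by apply/matrixP=> i j; rewrite !mxE edge_sym. Qed.

Definition common_neighbors G x y := #|[set z | G x z && G z y]|.

Lemma sum_enum_val (V : nmodType) (F : T -> V) :
  \sum_(i < #|T|) F (enum_val i) = \sum_x F x.
Proof. by rewrite -big_enum_val. Qed.

Lemma adjacency_sqr G i j :
  (adjacency G *m adjacency G) i j
    = (common_neighbors G (enum_val i) (enum_val j))%:R.
Proof.
rewrite mxE; under eq_bigr => l _ do rewrite !mxE -natrM mulnb.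
rewrite (sum_enum_val (fun z => (G (enum_val i) z && G z (enum_val j))%:R)).
by rewrite -natr_sum -big_mkcond sum1dep_card.
Qed.

Lemma adjacency_ones k G : regular k G ->
  adjacency G *m (const_mx 1 : 'M_#|T|) = k%:R *: const_mx 1.
Proof.
move=> hk; apply/matrixP=> i j; rewrite !mxE.
under eq_bigr => l _ do rewrite !mxE mulr1.
rewrite (sum_enum_val (fun z => (G (enum_val i) z)%:R)).
by rewrite -natr_sum -big_mkcond sum1dep_card hk mulr1.
Qed.

Lemma ones_adjacency k G : regular k G ->
  (const_mx 1 : 'M_#|T|) *m adjacency G = k%:R *: const_mx 1.
Proof.
move=> /adjacency_ones/(congr1 trmx).
by rewrite trmx_mul linearZ /= trmx_const adjacency_tr.
Qed.

Lemma ones_sqr :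
  (const_mx 1 : 'M[algC]_#|T|) *m (const_mx 1 : 'M_#|T|) = #|T|%:R *: const_mx 1.
Proof.
apply/matrixP=> i j; rewrite !mxE; under eq_bigr => l _ do rewrite !mxE mulr1.
by rewrite sumr_const card_ord mulr1.
Qed.

Lemma mem_spectrum G a : (a \in spectrum G) = eigenvalue (adjacency G) a.
Proof.
by rewrite eigenvalue_root_char char_poly_adjacency root_prod_XsubC.
Qed.

(** The adjacency matrix is real symmetric: this is the spectral theorem, with
    the diagonal entries identified as the roots of the characteristic
    polynomial. *)
Lemma spectrum_diag G :
  exists P : 'M[algC]_#|T|, exists d : 'rV[algC]_#|T|,
  [/\ P \in unitmx, adjacency G = invmx P *m diag_mx d *m P,
      perm_eq (spectrum G) [seq d 0 i | i : 'I_#|T|]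
    & forall i, d 0 i \is Num.real].
Proof.
have Ah : adjacency G \is hermsymmx.
  rewrite realsym_hermsym //.
    by apply/is_hermitianmxP; rewrite expr0 scale1r map_mx_id ?adjacency_tr.
  by apply/mxOverP=> i j; rewrite mxE realn.
exists (spectralmx (adjacency G)), (spectral_diag (adjacency G)).
have Pu := spectral_unit (adjacency G).
have AE := orthomx_spectralP (hermitian_normalmx Ah).
split=> // [|i]; last exact: (mxOverP (hermitian_spectral_diag_real Ah)).
by apply: prod_XsubC_eq; rewrite -char_poly_adjacency {1}AE char_poly_conj_diag.
Qed.

Lemma size_spectrum G : size (spectrum G) = #|T|.
Proof.
have [P [d [_ _ /perm_size-> _]]] := spectrum_diag G.
by rewrite size_map -cardE card_ord.
Qed.

(** Both sides are the trace of the adjacency matrix. *)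
Lemma sum_spectrum G :
  \sum_(z <- spectrum G) z = #|[set x | G x x]|%:R.
Proof.
have [P [d [Pu AE GE _]]] := spectrum_diag G; rewrite (perm_big _ GE).
rewrite big_map big_enum /= -mxtrace_diag -(mxtrace_conj _ Pu) -AE /mxtrace.
under eq_bigr => i _ do rewrite mxE.
rewrite (sum_enum_val (fun x => (G x x)%:R)).
by rewrite -natr_sum -big_mkcond sum1dep_card.
Qed.

(** Both sides are the trace of the square of the adjacency matrix. *)
Lemma sum_sqr_spectrum k G : regular k G ->
  \sum_(z <- spectrum G) z ^+ 2 = (#|T| * k)%:R.
Proof.
move=> hk; have [P [d [Pu AE GE _]]] := spectrum_diag G.
rewrite (perm_big _ GE).
have -> : \sum_(z <- [seq d 0 i | i : 'I_#|T|]) z ^+ 2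
    = \tr (diag_mx d *m diag_mx d).
  rewrite diag_sqr mxtrace_diag big_map big_enum /=.
  by apply: eq_bigr => i _; rewrite mxE.
rewrite -(mxtrace_conj _ Pu) -conj_sqr // -AE /mxtrace.
have cE x : common_neighbors G x x = k.
  by rewrite -(hk x); apply: eq_card => z; rewrite !inE [G z x]edge_sym andbb.
under eq_bigr => i _ do rewrite adjacency_sqr cE.
by rewrite sumr_const card_ord mulnC natrM mulr_natr.
Qed.

(** The numbers of common neighbours are the entries of the square of the
    adjacency matrix, so both squares have the same eigenvalues, and the absolute
    value of a real eigenvalue is the square root of its square. *)
Lemma common_neighbors_norm_spectrum G H :
  (forall x y, common_neighbors G x y = common_neighbors H x y) ->
  perm_eq [seq `|z| | z <- spectrum G] [seq `|z| | z <- spectrum H].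
Proof.
move=> hGH.
have [P [d [Pu AE GE dr]]] := spectrum_diag G.
have [Q [e [Qu BE HE er]]] := spectrum_diag H.
have sqE : perm_eq [seq d 0 i ^+ 2 | i : 'I_#|T|] [seq e 0 i ^+ 2 | i : 'I_#|T|].
  have hA : adjacency G *m adjacency G = adjacency H *m adjacency H.
    by apply/matrixP=> i j; rewrite !adjacency_sqr hGH.
  have := congr1 char_poly hA.
  rewrite AE BE !conj_sqr // !diag_sqr !char_poly_conj_diag //.
  move/prod_XsubC_eq; congr perm_eq; apply: eq_map => i; by rewrite mxE.
have normE (s : 'rV[algC]_#|T|) : (forall i, s 0 i \is Num.real) ->
    [seq `|z| | z <- [seq s 0 i | i : 'I_#|T|]]
    = [seq sqrtC z | z <- [seq s 0 i ^+ 2 | i : 'I_#|T|]].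
  move=> sr; rewrite -!map_comp; apply: eq_map => i /=.
  by rewrite -real_normK // sqrCK.
apply: perm_trans (perm_map _ GE) _.
rewrite perm_sym; apply: perm_trans (perm_map _ HE) _.
by rewrite !normE // perm_map // perm_sym.
Qed.

Lemma common_neighbors_energy G H :
  (forall x y, common_neighbors G x y = common_neighbors H x y) ->
  energy G = energy H.
Proof.
move=> /common_neighbors_norm_spectrum hGH.
by rewrite /energy -!(big_map Num.norm predT id); apply: perm_big.
Qed.

(** A way to get the energy from the set of eigenvalues alone: if the absolute
    value agrees with a quadratic polynomial on this set, then only the size of
    the spectrum and its first two power sums matter. *)
Lemma energy_quadratic k G (a b c : algC) : regular k G ->
  (forall z, z \in spectrum G -> `|z| = a + b * z + c * z ^+ 2) ->
  energy G = a *+ #|T| + b * #|[set x | G x x]|%:R + c * (#|T| * k)%:R.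
Proof.
move=> hk hz; rewrite /energy (eq_big_seq _ hz) !big_split /= -!mulr_sumr.
rewrite sum_spectrum (sum_sqr_spectrum hk) big_const_seq count_predT.
by rewrite size_spectrum iter_addr_0.
Qed.

Lemma le_ramanujan_bound n d : (0 < d)%N -> (n ^ 2 <= 4 * (d - 1))%N ->
  n%:R <= 2 * sqrtC (d%:R - 1) :> algC.
Proof.
move=> d0 hn.
have -> : d%:R - 1 = (d - 1)%:R :> algC by rewrite natrB.
rewrite -(@ler_pXn2r _ 2) ?nnegrE ?ler0n ?mulr_ge0 ?sqrtC_ge0 ?ler0n //.
by rewrite exprMn sqrtCK -!natrX -natrM ler_nat.
Qed.

(** The Ramanujan condition only sees the degree and the absolute values of the
    eigenvalues. *)
Lemma common_neighbors_ramanujan k G H : regular k G -> regular k H ->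
  (forall x y, common_neighbors G x y = common_neighbors H x y) ->
  (forall a, eigenvalue (adjacency G) a ->
     `|a| != k%:R -> `|a| <= 2 * sqrtC (k%:R - 1)) ->
  ramanujan H.
Proof.
move=> hG hH /common_neighbors_norm_spectrum/perm_mem hGH hk; exists k => // b.
rewrite -mem_spectrum => /(map_f Num.norm); rewrite -hGH => /mapP[a].
by rewrite mem_spectrum => /hk + ->.
Qed.

(** * Complete multipartite graphs and their complements *)

(** The hypotheses describe the complete multipartite graphs with parts of size
    m: nonadjacent vertices have the same k neighbours, and adjacent ones have
    k - m common neighbours.  Counting instead of naming the parts gives the
    square of the adjacency matrix at once. *)
Section Multipartite.
Variables (G : graph T) (k m : nat).
Hypothesis hk : regular k G.
Hypothesis hcn : forall x y, (common_neighbors G x y + m * G x y = k)%N.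
Hypothesis hT : #|T| = (k + m)%N.
Hypothesis m_gt0 : (0 < m)%N.

Let J : 'M[algC]_#|T| := const_mx 1.

Lemma multipartite_loopless x : G x x = false.
Proof.
have := hcn x x.
suff -> : common_neighbors G x x = k by by case: (G x x); lia.
by rewrite -(hk x); apply: eq_card => z; rewrite !inE [G z x]edge_sym andbb.
Qed.

Lemma multipartite_adjacency_sqr :
  adjacency G *m adjacency G = k%:R *: J - m%:R *: adjacency G.
Proof.
apply/matrixP=> i j; rewrite adjacency_sqr !mxE mulr1 -natrM.
by rewrite -(hcn (enum_val i) (enum_val j)) natrD addrK.
Qed.

(** Applying A ^ 2 + m A = k J to an eigenvector v with eigenvalue a yields
    (a ^ 2 + m a) v = k v J.  A further multiplication by A scales the left-hand
    side by a and, since J A = k J, the right-hand side by k. *)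
Lemma multipartite_eigenvalue a : eigenvalue (adjacency G) a ->
  a \in [:: 0; - m%:R; k%:R].
Proof.
case/eigenvalueP=> v va v0.
have h1 : (a * a + m%:R * a) *: v = k%:R *: (v *m J).
  have : v *m (adjacency G *m adjacency G) = (a * a) *: v.
    by rewrite mulmxA va -scalemxAl va scalerA.
  rewrite multipartite_adjacency_sqr mulmxBr -!scalemxAr va scalerDl => <-.
  by rewrite scalerA subrK.
have h2 : (a * (a + m%:R) * (a - k%:R)) *: v = 0.
  have := congr1 (mulmx^~ (adjacency G)) h1.
  rewrite /= -!scalemxAl va -mulmxA (ones_adjacency hk) -!scalemxAr.
  rewrite -h1 !scalerA => /eqP; rewrite -subr_eq0 -scalerBl => /eqP <-.
  congr (_ *: v); ring.
move/eqP: h2; rewrite scaler_eq0 (negPf v0) orbF !mulf_eq0.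
by rewrite addr_eq0 subr_eq0 !inE orbA.
Qed.

(** The complement has adjacency matrix B - 1, where B = J - A is the matrix of
    the relation of lying in the same part, which satisfies B ^ 2 = m B. *)
Lemma compl_multipartite_eigenvalue a :
  eigenvalue (adjacency (compl_graph G)) a -> a \in [:: -1; m%:R - 1].
Proof.
case/eigenvalueP=> v va v0.
set B := J - adjacency G.
have CE : adjacency (compl_graph G) = B - 1%:M.
  apply/matrixP=> i j; rewrite !mxE /= /compl_rel (inj_eq enum_val_inj).
  have [<-|] := eqVneq i j; first by rewrite multipartite_loopless subr0 subrr.
  by case: (G _ _); rewrite ?subrr ?subr0.
have BB : B *m B = m%:R *: B.
  rewrite /B mulmxBl !mulmxBr ones_sqr (adjacency_ones hk) (ones_adjacency hk).
  rewrite multipartite_adjacency_sqr.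
  have -> : #|T|%:R = k%:R + m%:R :> algC by rewrite hT natrD.
  by rewrite scalerDl [X in X - k%:R *: _]addrC addrK subKr scalerBr.
have vB : v *m B = (a + 1) *: v.
  by rewrite scalerDl scale1r -va CE [v *m (_ - 1%:M)]mulmxBr mulmx1 subrK.
have /eqP : (a + 1) * (a + 1 - m%:R) *: v = 0.
  rewrite mulrBr scalerBl -scalerA -vB scalemxAl -vB -mulmxA BB -scalemxAr.
  by rewrite vB scalerA mulrC subrr.
rewrite scaler_eq0 (negPf v0) orbF mulf_eq0 addr_eq0 !inE.
by rewrite -[a + 1 - _]addrA addr_eq0 opprB.
Qed.

Lemma multipartite_energy : energy G = (k.*2)%:R.
Proof.
have m0 : m%:R != 0 :> algC by rewrite pnatr_eq0 -lt0n.
have r0 : k%:R + m%:R != 0 :> algC by rewrite -natrD pnatr_eq0 -lt0n; lia.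
have ll : #|[set x | G x x]| = 0%N.
  by apply: eq_card0 => x; rewrite inE multipartite_loopless.
(* The quadratic polynomial without constant term that takes the values m at
   - m and k at k. *)
rewrite (@energy_quadratic k G 0 (1 - 2 * k%:R / (k%:R + m%:R))
  (2 / (k%:R + m%:R))) //.
  rewrite ll hT natrM -muln2 natrM; field; exact: r0.
move=> z; rewrite mem_spectrum => /multipartite_eigenvalue.
rewrite !inE => /or3P[]/eqP->; rewrite ?normr0 ?normrN ?normr_nat.
- by rewrite expr0n !mulr0 !addr0.
- field; exact: r0.
- field; exact: r0.
Qed.

Lemma compl_regular : regular (m - 1) (compl_graph G).
Proof.
move=> x.
have := cardsC [set y | G x y]; rewrite hk hT => /addnI hc.
rewrite -hc [in RHS](cardsD1 x) inE inE multipartite_loopless /= add1n subn1 /=.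
by apply: eq_card => y; rewrite !inE /= /compl_rel eq_sym.
Qed.

(** Multiplying by m keeps the right-hand side a natural number, which makes
    energies comparable by arithmetic on cardinals. *)
Lemma compl_multipartite_energy :
  energy (compl_graph G) * m%:R = (#|T| * (m - 1)).*2%:R.
Proof.
have m0 : m%:R != 0 :> algC by rewrite pnatr_eq0 -lt0n.
have ll : #|[set x | compl_graph G x x]| = 0%N.
  by apply: eq_card0 => x; rewrite inE /= /compl_rel eqxx.
(* The affine function that takes the values 1 at - 1 and m - 1 at m - 1. *)
rewrite (@energy_quadratic _ _ (2 * (m - 1)%:R / m%:R) (1 - 2 / m%:R) 0
  compl_regular).
  rewrite ll -muln2 !natrM -mulr_natr; field; exact: m0.
move=> z; rewrite mem_spectrum => /compl_multipartite_eigenvalue.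
have -> : m%:R - 1 = (m - 1)%:R :> algC by rewrite natrB.
rewrite !inE => /orP[]/eqP->; rewrite ?normrN ?normr1 ?normr_nat natrB //.
- field; exact: m0.
- field; exact: m0.
Qed.

Lemma compl_multipartite_ramanujan : (2 < m)%N -> ramanujan (compl_graph G).
Proof.
move=> m2; exists (m - 1)%N; first exact: compl_regular.
move=> a /compl_multipartite_eigenvalue; rewrite !inE natrB //.
case/orP=> /eqP->; last by rewrite -natrB // normr_nat eqxx.
rewrite normrN normr1 -natrB // => _.
by apply: (@le_ramanujan_bound 1); lia.
Qed.

Lemma multipartite_ramanujan H : (m ^ 2 <= 4 * (k - 1))%N ->
  regular k H ->
  (forall x y, common_neighbors G x y = common_neighbors H x y) ->
  ramanujan H.
Proof.
move=> mk hH hc; apply: (common_neighbors_ramanujan hk hH hc) => a.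
move=> /multipartite_eigenvalue.
rewrite !inE => /or3P[]/eqP->; rewrite ?normr0 ?normrN ?normr_nat ?eqxx // => _.
  by apply: (@le_ramanujan_bound 0); nia.
apply: le_ramanujan_bound => //; nia.
Qed.
End Multipartite.
End Spectra.

(** * Unitary Cayley graphs of finite local rings *)

Section Cayley.
Variable R : finComUnitRingType.
Implicit Types x y u : R.

Lemma nonunit_in_maximal_ideal x : x \isn't a GRing.unit ->
  exists2 I : {set R}, maximal_ideal I & x \in I.
Proof.
move=> xU.
(* The boolean form of being a proper ideal, as needed to extract a maximal
   set. *)
pose P (S : {set R}) := [&& 0 \in S, 1 \notin S &
  [forall a, forall u in S, forall v in S, a * u + v \in S]].
have PP (S : {set R}) : reflect (idealr_closed S) (P S).
  apply: (iffP and3P) => [[S0 S1 /forallP hS]|[S0 S1 hS]]; split=> //.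
    by move=> a u v uS vS; have /forall_inP/(_ u uS)/forall_inP/(_ v vS) := hS a.
  by apply/forallP=> a; apply/forall_inP=> u uS; apply/forall_inP=> v; apply: hS.
have Px : P [set x * y | y : R].
  apply/PP; split; first by apply/imsetP; exists 0; rewrite ?mulr0.
    apply/imsetP=> -[y _ xy]; case/negP: xU.
    by apply/unitrPr; exists y.
  move=> a _ _ /imsetP[y _ ->] /imsetP[z _ ->]; apply/imsetP.
  by exists (a * y + z); rewrite // mulrDr mulrCA.
have [I /maxsetP[/PP hI maxI] sxI] := maxset_exists Px.
exists I; first by split=> // J /PP hJ sIJ; apply: maxI.
by apply: (subsetP sxI); apply/imsetP; exists 1; rewrite ?mulr1.
Qed.

(** A unit in m would put 1 in m, and a nonunit lies in some maximal ideal, of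
    which m is the only one. *)
Lemma local_ringE (m : {set R}) : local_ring m ->
  forall x, (x \in m) = (x \isn't a GRing.unit).
Proof.
case=> -[[m0 m1 hm] _] muniq x.
apply/idP/idP => [xm|/nonunit_in_maximal_ideal[I]].
  apply: contra m1 => xU; rewrite -(mulVr xU) -[_ * _]addr0; exact: hm.
by move/muniq->.
Qed.

Lemma unitary_cayley_regular :
  regular #|[set x : R | x \is a GRing.unit]| (unitary_cayley R).
Proof.
move=> x; rewrite -[RHS](card_preimset _ (addIr (- x))).
by apply: eq_card => y; rewrite !inE.
Qed.

Lemma unitary_cayley_sum_regular :
  regular #|[set x : R | x \is a GRing.unit]| (unitary_cayley_sum R).
Proof.
move=> x; rewrite -[RHS](card_preimset _ (addrI x)).
by apply: eq_card => y; rewrite !inE.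
Qed.

(** The negation z -> - z maps the common neighbours in one graph onto those in
    the other one. *)
Lemma common_neighbors_cayley_sum x y :
  common_neighbors (unitary_cayley R) x y
    = common_neighbors (unitary_cayley_sum R) x y.
Proof.
rewrite /common_neighbors -(card_preimset _ oppr_inj); apply: eq_card => z.
rewrite !inE /= /cayley_rel /cayley_sum_rel -opprD unitrN opprK.
by rewrite addrC [y + z]addrC.
Qed.

(** If #|R| is even, then Cauchy's theorem gives a nonzero x with 2 x = 0.  If
    #|R| = 2 s + 1, then #|R| annihilates 1, so that 2 (- s) = 1. *)
Lemma unit2_odd : (2 : R) \is a GRing.unit = odd #|R|.
Proof.
apply/idP/idP => [u2|oR].
  apply: contraT; rewrite -dvdn2 -cardsT => /(Cauchy (isT : prime 2))[x _ ox].
  have : (x ^+ 2)%g = 1%g by rewrite -ox expg_order.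
  rewrite FinRing.zmodXgE FinRing.zmod1gE -mulr_natl => /(canRL (mulKr u2)) x0.
  by move: ox; rewrite x0 mulr0 -FinRing.zmod1gE order1.
have : (1 : R) *+ #|R| = 0.
  by rewrite -FinRing.zmodXgE -cardsT expg_cardG ?inE.
rewrite -[X in _ *+ X]odd_double_half oR add1n mulrS => /eqP.
rewrite addr_eq0 => /eqP h; apply/unitrPr; exists (- (#|R|./2)%:R).
by rewrite mulrN -natrM mul2n -h.
Qed.

Lemma card_loops_cayley_sum : (2 : R) \is a GRing.unit ->
  #|[set x | unitary_cayley_sum R x x]| = #|[set x : R | x \is a GRing.unit]|.
Proof.
move=> u2; apply: eq_card => x; rewrite !inE /= /cayley_sum_rel.
by rewrite -mulr2n -mulr_natl unitrMr.
Qed.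

Variable m : {set R}.
Hypothesis hm : local_ring m.

Lemma card_local : #|R| = (#|[set x : R | x \is a GRing.unit]| + #|m|)%N.
Proof.
rewrite -(cardsC m) addnC; congr (_ + _)%N; apply: eq_card => x.
by rewrite !inE (local_ringE hm) negbK.
Qed.

Lemma unitrD_local x y : y \in m ->
  (x + y \is a GRing.unit) = (x \is a GRing.unit).
Proof.
have [[[_ _ mP] _] _] := hm.
move=> ym; apply: negb_inj; rewrite -!(local_ringE hm).
apply/idP/idP => xm; last by rewrite -[x]mul1r mP.
by rewrite -[x](addrK y) -mulN1r addrC mP.
Qed.

(** Here x + y = (y - x) + 2 x with 2 x in m. *)
Lemma cayley_sum_char2 : (2 : R) \isn't a GRing.unit ->
  unitary_cayley_sum R =2 unitary_cayley R.
Proof.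
move=> n2 x y; rewrite /= /cayley_rel /cayley_sum_rel.
rewrite -(@unitrD_local (y - x) (x *+ 2)).
  by rewrite mulr2n addrA subrK addrC.
by rewrite (local_ringE hm) -mulr_natl unitrM (negPf n2).
Qed.

(** Of the neighbours z of x, those not adjacent to y lie in the coset y + m.
    This coset consists of neighbours of x if x and y are adjacent, and contains
    none otherwise. *)
Lemma common_neighbors_cayley_local x y :
  (common_neighbors (unitary_cayley R) x y + #|m| * unitary_cayley R x y)%N
    = #|[set x : R | x \is a GRing.unit]|.
Proof.
rewrite -(unitary_cayley_regular x).
rewrite -[RHS](cardsID [set z | unitary_cayley R z y]); congr (_ + _)%N.
  by apply: eq_card => z; rewrite !inE.
have -> : [set z | unitary_cayley R x z] :\: [set z | unitary_cayley R z y] =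
    if unitary_cayley R x y then [set z | y - z \in m] else set0.
  apply/setP=> z; rewrite !inE.
  have -> : unitary_cayley R z y = (y - z \notin m).
    by rewrite (local_ringE hm) negbK.
  rewrite negbK; have [zm|zm] /= := boolP (y - z \in m).
    have -> : cayley_rel x z = cayley_rel x y.
      by rewrite /cayley_rel -(unitrD_local (z - x) zm) [z - x + _]addrC subrKA.
    by case: ifP; rewrite !inE ?zm.
  by case: ifP; rewrite !inE ?(negPf zm).
case: (unitary_cayley R x y); last by rewrite muln0 cards0.
rewrite muln1 -[LHS](card_preimset _ (@subrI _ y)).
by apply: eq_card => z; rewrite !inE.
Qed.

End Cayley.

Theorem corollary5p2 (R : finComUnitRingType) (m : {set R})
    (hR : local_ring m) :
  let Gs := [:: unitary_cayley R; unitary_cayley_sum R;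
                compl_graph (unitary_cayley R)] in
  [/\ equienergetic Gs, non_isospectral Gs & all_ramanujan Gs] <->
  (#|R| = #|m| ^ 2)%N /\ odd #|R|.
Proof.
set k := #|[set x : R | x \is a GRing.unit]|.
have hk : regular k (unitary_cayley R) := @unitary_cayley_regular R.
have hk' : regular k (unitary_cayley_sum R) := @unitary_cayley_sum_regular R.
have hc := common_neighbors_cayley_local hR.
have hT : #|R| = (k + #|m|)%N := card_local hR.
have k0 : (0 < k)%N by apply/card_gt0P; exists 1; rewrite inE unitr1.
have m0 : (0 < #|m|)%N.
  by apply/card_gt0P; exists 0; have [[[]]] := hR.
have hE := multipartite_energy hk hc hT m0.
have hEc := compl_multipartite_energy hk hc hT m0.
have eqE :
  (energy (unitary_cayley R) == energy (compl_graph (unitary_cayley R)))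
    = (#|R| == #|m| ^ 2)%N.
  have mC : #|m|%:R != 0 :> algC by rewrite pnatr_eq0 -lt0n.
  rewrite -(inj_eq (mulIf mC)) hE hEc -natrM eqr_nat hT -(prednK m0) subn1 /=.
  by move: #|m|.-1 => n; apply/eqP/eqP; nia.
rewrite /=; split=> [[hen his _]|[hr hodd]].
  move: hen; rewrite /equienergetic /= eqE => /and3P[/andP[_ /andP[/eqP ? _]] _ _].
  split=> //; rewrite -unit2_odd; apply: contraT => n2.
  move: his; rewrite /non_isospectral /=.
  suff AE : adjacency (unitary_cayley R) = adjacency (unitary_cayley_sum R).
    by rewrite {1}/spectrum AE perm_refl.
  by apply/matrixP=> i j; rewrite !mxE (cayley_sum_char2 hR n2).
have m3 : (2 < #|m|)%N.
  have om : odd #|m| by move: hodd; rewrite hr oddX.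
  have m1 : #|m| != 1%N by apply/eqP => m1; move: hT; rewrite hr m1 exp1n; lia.
  by case: #|m| om m1 => [|[|[|]]].
split.
- have e1 : energy (unitary_cayley R) = energy (unitary_cayley_sum R).
    exact: common_neighbors_energy (@common_neighbors_cayley_sum R).
  by rewrite /equienergetic /= -e1 eqE hr !eqxx.
- have loop0 : #|[set x | unitary_cayley R x x]| = 0%N.
    by apply: eq_card0 => x; rewrite inE (multipartite_loopless hk hc).
  have loopc : #|[set x | compl_graph (unitary_cayley R) x x]| = 0%N.
    by apply: eq_card0 => x; rewrite inE /= /compl_rel eqxx.
  have loopS : #|[set x | unitary_cayley_sum R x x]| = k.
    by rewrite card_loops_cayley_sum // unit2_odd.
  have kc := compl_regular hk hc hT m0.
  have per (f : algC -> algC) (G H : graph R) :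
      perm_eq (spectrum G) (spectrum H) ->
      \sum_(z <- spectrum G) f z = \sum_(z <- spectrum H) f z.
    by move=> ?; apply: perm_big.
  rewrite /non_isospectral /= !andbT -andbA; apply/and3P; split; apply/negP.
  + move/(per id); rewrite !sum_spectrum loop0 loopS => /eqP; rewrite eqr_nat; lia.
  + move/(per (fun z => z ^+ 2)).
    rewrite (sum_sqr_spectrum hk) (sum_sqr_spectrum kc) => /eqP.
    rewrite eqr_nat eqn_pmul2l; last by rewrite hT addn_gt0 k0.
    move/eqP=> kE; move: hr; rewrite hT kE expnS expn1.
    by move: #|m| m3 => n; nia.
  + move/(per id); rewrite !sum_spectrum loopc loopS => /eqP; rewrite eqr_nat; lia.
- have mk : (#|m| ^ 2 <= 4 * (k - 1))%N.
    move: hT m3; rewrite hr !expnS expn0 muln1.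
    by clear; move: k #|m| => a b; nia.
  split; first exact: (multipartite_ramanujan hk hc hT m0 mk hk).
  split; first exact: (multipartite_ramanujan hk hc hT m0 mk hk'
              (@common_neighbors_cayley_sum R)).
  by split=> //; apply: (compl_multipartite_ramanujan hk hc).
Qed.
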